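(* Let $(X,d)$ be a finite metric space that can be isometrically embedded into a Hilbert space, and let $G=(X,E,w)$ be the critical graph associated with $(X,d)$. If $G$ is $2$-connected but not $3$-connected, then $G$ contains a Hamiltonian path $v_1,\ldots,v_{|X|}$ and there is some integer $k$ with $2\le k\le |X|-1$ such that, for all $1\le i<j\le |X|$, the vertices $v_i$ and $v_j$ are adjacent in $G$ if and only if $j-i=1$ or $i<k<j$.
   Context: For a finite metric space $(X,d)$, the critical graph is the weighted graph $G=(X,E,w)$ with vertex set $X$, edge set $E=\{\{u,v\} : u\ne v,\ d(u,v)<d(u,z)+d(z,v)\text{ for all } z\in X\setminus\{u,v\}\}$, and weights $w(\{u,v\})=d(u,v)$. Isometrically embeddable into a Hilbert space means there is a real Hilbert space $\mathcal{H}$ and a map $\phi:X\to\mathcal{H}$ with $\|\phi(x)-\phi(y)\|_{\mathcal{H}}=d(x,y)$ for all $x,y\in X$. A graph is $m$-connected if it has more than $m$ vertices and remains connected after deleting any set of fewer than $m$ vertices. A Hamiltonian path is a path visiting every vertex exactly once. *)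

(* Defs.v *)
From HB Require Import structures.
From mathcomp Require Import all_boot all_order all_algebra.
From mathcomp Require Import sesquilinear.
From mathcomp Require Import reals topology normedtype.

Set Implicit Arguments.
Unset Strict Implicit.
Unset Printing Implicit Defensive.

Import Order.TTheory GRing.Theory Num.Theory.

Local Open Scope ring_scope.

#[short(type="finMetricType")]
HB.structure Definition FinMetric (R : numDomainType) :=
  {X of Finite X & Metric R X}.

(* A real Hilbert space is a complete normed module whose norm is induced by
   an inner product: [{dot H for idfun}] is the type of positive definite
   symmetric bilinear forms on [H]. *)
Definition hilbert_norm (R : realType) (H : completeNormedModType R) : Prop :=
  exists ip : {dot H for idfun}, forall x : H, `|x| ^+ 2 = ip x x.

Definition hilbert_embeddable (R : realType) (X : finMetricType R) : Prop :=
  exists (H : completeNormedModType R) (phi : X -> H),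
    hilbert_norm H /\ forall x y : X, `|phi x - phi y| = mdist x y.

(* Adjacency in the critical graph.  The weight of an edge [u v] is
   [mdist u v]; connectivity and paths depend on adjacency only. *)
Definition critical (R : realType) (X : finMetricType R) : rel X :=
  fun u v => (u != v) &&
    [forall z : X, (z != u) && (z != v) ==>
       (mdist u v < mdist u z + mdist z v)].

Definition delete_vertices (V : finType) (e : rel V) (S : {set V}) : rel V :=
  fun u v => [&& u \notin S, v \notin S & e u v].

Definition vertex_connected (V : finType) (e : rel V) (m : nat) : Prop :=
  (m < #|V|)%N /\
  forall S : {set V}, (#|S| < m)%N ->
    forall x y : V, x \notin S -> y \notin S ->
      connect (delete_vertices e S) x y.

Definition hamiltonian_path (V : finType) (e : rel V) (v : 'I_#|V| -> V)
    : Prop :=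
  bijective v /\
  forall i j : 'I_#|V|, j = i.+1 :> nat -> e (v i) (v j).

Lemma critical_irr (R : realType) (X : finMetricType R) :
  irreflexive (@critical R X).
Proof. by move=> u; rewrite /critical eqxx. Qed.

Lemma critical_sym (R : realType) (X : finMetricType R) :
  symmetric (@critical R X).
Proof.
move=> u v; rewrite /critical eq_sym (metric_sym u v); congr (_ && _).
apply: eq_forallb => z.
by rewrite andbC addrC (metric_sym u z) (metric_sym z v).
Qed.

(* Main.v *)
Require Import Defs.
From HB Require Import structures.
From mathcomp Require Import all_boot all_order all_algebra.
From mathcomp Require Import sesquilinear boolp.
From mathcomp Require Import reals topology normedtype.
From mathcomp Require Import ring lra.

(* In a Hilbert space [u] and [v] are non-adjacent exactly when another point
   lies on the segment [u v].  Let {p, q} separate A from B.  Moving from [a] in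
   A to [b] in B along the points of the segment, one must pass through [p] or
   [q], so every segment from A to B contains [p] or [q].  The points are not
   all collinear (a path is not 2-connected), so either all these segments
   contain the same one of [p], [q], and X is a line plus one point (then [o]
   below is an end of the line), or some [a], say in A, has segments of both
   kinds.  In that case A = {a}, because for another [a'] in A the four segments
   would force [p - a] and [q - a] to be parallel.  Either way X lies on two rays with a common apex [o], and the path
   runs down one ray to [o = v_k] and up the other. *)

Set Implicit Arguments.
Unset Strict Implicit.
Unset Printing Implicit Defensive.

Import Order.TTheory GRing.Theory Num.Theory.

Local Open Scope ring_scope.

(** The reals are positions as in [two_rays], negative on one ray and positive on the other. If
    [x < 0 < y], both right-hand sides are positive and [z] would have both signs; otherwise one
    equation reads [z = (1 - t) * x + t * y]. *)
Lemma signed_convex (R : realType) (x y z t : R) : x < y -> 0 < t < 1 ->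
  Num.max (- z) 0 = (1 - t) * Num.max (- x) 0 + t * Num.max (- y) 0 ->
  Num.max z 0 = (1 - t) * Num.max x 0 + t * Num.max y 0 ->
  x < z < y /\ ~~ (x < 0 < y).
Proof.
move=> xy /andP[t0 t1] eN eP; rewrite negb_and -!leNgt.
have s0 : 0 < 1 - t by lra.
have pt : 0 < t * (y - x) by rewrite mulr_gt0 // subr_gt0.
have ps : 0 < (1 - t) * (y - x) by rewrite mulr_gt0 // subr_gt0.
have neg (r : R) : r < 0 -> Num.max (- r) 0 = - r /\ Num.max r 0 = 0.
  by move=> r0; split; [rewrite max_l|rewrite max_r]; lra.
have pos (r : R) : 0 <= r -> Num.max (- r) 0 = 0 /\ Num.max r 0 = r.
  by move=> r0; split; [rewrite max_r|rewrite max_l]; lra.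
have [x0|x0] := boolP (0 <= x).
  have y0 : 0 < y by exact: le_lt_trans xy.
  have py : 0 < t * y by rewrite mulr_gt0.
  have px : 0 <= (1 - t) * x by apply: mulr_ge0 => //; exact: ltW.
  move: eP; rewrite (pos x x0).2 (pos y (ltW y0)).2 => eP; split=> //.
  case: (lerP z 0) eP => z0 e; last by lra.
  exfalso; lra.
rewrite -ltNge in x0.
have px : 0 < (1 - t) * - x by rewrite mulr_gt0 // oppr_gt0.
have [y0|y0] := boolP (y <= 0).
  have py : 0 <= t * - y by apply: mulr_ge0; lra.
  have Ey : Num.max (- y) 0 = - y by rewrite max_l //; lra.
  move: eN; rewrite (neg x x0).1 Ey => eN; split=> //.
  case: (lerP (- z) 0) eN => z0 e; first by (exfalso; lra).
  lra.
rewrite -ltNge in y0; have py : 0 < t * y by rewrite mulr_gt0.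
move: eN eP; rewrite (neg x x0).1 (neg x x0).2 (pos y (ltW y0)).1 (pos y (ltW y0)).2.
have [z0|z0] := boolP (0 <= z); first by rewrite (pos z z0).1; lra.
by rewrite -ltNge in z0; rewrite (neg z z0).2; lra.
Qed.

(** * Segments, lines and pairs of rays in scalar coordinates *)

Section Geometry.
Variables (R : realType) (I : Type) (X : finType) (F : I -> X -> R).

Definition btw (x z y : X) : Prop :=
  exists t : R, 0 <= t <= 1 /\ forall i, F i z = (1 - t) * F i x + t * F i y.

Definition collinear : Prop :=
  exists (c u : I -> R) (g : X -> R), forall x i, F i x = c i + g x * u i.

Definition independent (u w : I -> R) : Prop :=
  forall a b : R, (forall i, a * u i + b * w i = 0) -> a = 0 /\ b = 0.

(* [f] is a signed coordinate on the union of two rays with apex [o]: [- f] is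
   the position along [u], [f] the position along [w]. *)
Definition two_rays (o : X) (f : X -> R) : Prop :=
  (exists u w : I -> R, independent u w /\
     forall x i, F i x = F i o + Num.max (- f x) 0 * u i + Num.max (f x) 0 * w i)
  /\ (exists x, f x < 0) /\ (exists x, 0 < f x).

Hypothesis F_inj : forall x y, (forall i, F i x = F i y) -> x = y.

Lemma btw_sym x z y : btw x z y -> btw y z x.
Proof.
case=> t [t01 E]; exists (1 - t); split; first by lra.
by move=> i; rewrite E; ring.
Qed.

(** Here [s] is the inverse of the convex parameter, nonzero because [a != p]. The bound [1 <= s]
    later excludes configurations by sign. *)
Lemma btw_ray a p b : btw a p b -> a != p ->
  exists2 s : R, 1 <= s & forall i, F i b = F i a + s * (F i p - F i a).
Proof.
case=> t [t01 E] pa.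
have t0 : 0 < t.
  rewrite lt_neqAle eq_sym (andP t01).1 andbT; apply: contra_neq pa => t0.
  by apply: F_inj => i; rewrite E t0; ring.
exists t^-1; first by rewrite invf_ge1 //; lra.
by move=> i; rewrite E; field; lra.
Qed.

Lemma line_btw (c u : I -> R) (g : X -> R) x z y :
  (forall i, F i x = c i + g x * u i) -> (forall i, F i z = c i + g z * u i) ->
  (forall i, F i y = c i + g y * u i) ->
  g x < g z < g y -> btw x z y.
Proof.
move=> Ex Ez Ey xzy; exists ((g z - g x) / (g y - g x)); split.
  by apply/andP; split; [rewrite divr_ge0; lra | rewrite ler_pdivrMr; lra].
by move=> i; rewrite Ex Ez Ey; field; lra.
Qed.

(** A linear relation between [p - o] and [q - o] would put all points on one line through [o]. The
    coordinate [f x] is [- t] on the ray through [p] and [t] on the ray through [q]. *)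
Lemma star_two_rays (o p q : X) : ~ collinear ->
  (forall x, exists2 t : R, 0 <= t &
     (forall i, F i x = F i o + t * (F i p - F i o)) \/
     (forall i, F i x = F i o + t * (F i q - F i o))) ->
  exists f, two_rays o f.
Proof.
move=> ncol rays.
have indep : independent (fun i => F i p - F i o) (fun i => F i q - F i o).
  move=> a b E; apply: contrapT => ab0; apply: ncol.
  have [a0|a0] := eqVneq a 0.
    have b0 : b != 0 by apply/eqP => b0; case: ab0.
    have Q i : F i q - F i o = 0.
      apply: (mulfI b0); rewrite mulr0.
      by have := E i; rewrite a0 mul0r add0r.
    exists (F^~ o), (fun i => F i p - F i o).
    apply: (@fin_all_exists _ _ (fun x gx => forall i, F i x = _ + gx * _)) => x.
    have [t _ [Ex|Ex]] := rays x; first by exists t.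
    by exists 0 => i; rewrite Ex Q; ring.
  have P i : F i p - F i o = (- b / a) * (F i q - F i o).
    apply: (mulfI a0); transitivity (- (b * (F i q - F i o))).
      by have := E i; lra.
    by field.
  exists (F^~ o), (fun i => F i q - F i o).
  apply: (@fin_all_exists _ _ (fun x gx => forall i, F i x = _ + gx * _)) => x.
  have [t _ [Ex|Ex]] := rays x; last by exists t.
  by exists (t * (- b / a)) => i; rewrite Ex P; ring.
have {rays} [f Ef] : exists f : X -> R, forall x i, F i x = F i o +
    Num.max (- f x) 0 * (F i p - F i o) + Num.max (f x) 0 * (F i q - F i o).
  apply: (@fin_all_exists _ _ (fun x fx => forall i, F i x = _ +
    Num.max (- fx) 0 * _ + Num.max fx 0 * _)) => x.
  have [t t0 [Ex|Ex]] := rays x; [exists (- t) => i | exists t => i];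
    by rewrite Ex ?opprK (max_l t0) max_r; lra.
exists f; split; first by exists (fun i => F i p - F i o), (fun i => F i q - F i o).
split.
(* Independence, applied to the equation of [p] itself, forces [Num.max (- f p) 0 = 1]. *)
- exists p; have [] := indep (1 - Num.max (- f p) 0) (- Num.max (f p) 0).
    by move=> i; have := Ef p i; lra.
  by case: (lerP (- f p) 0); lra.
- exists q; have [] := indep (- Num.max (- f q) 0) (1 - Num.max (f q) 0).
    by move=> i; have := Ef q i; lra.
  by case: (lerP (f q) 0); lra.
Qed.

(** Seen from [a0] through [p], all of [B] is on one line; seen from [b0], so is all of [A]. This
    line is one ray from its end, and [q] spans the other. *)
Lemma one_type (A B : X -> Prop) (p q a0 b0 : X) : ~ collinear ->
  (forall x, [\/ A x, B x, x = p | x = q]) ->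
  p != q -> (forall a, A a -> a != p /\ a != q) -> (forall b, B b -> b != p) ->
  A a0 -> B b0 -> (forall a b, A a -> B b -> btw a p b) ->
  exists o f, two_rays o f.
Proof.
move=> ncol cover pq Apq Bp Aa0 Bb0 H.
have [a0p a0q] := Apq _ Aa0.
have opp a b : A a -> B b ->
    exists r : R, forall i, F i b - F i p = r * (F i a - F i p).
  move=> Aa Bb; have [pa _] := Apq a Aa.
  have [s s1 E] := btw_ray (H _ _ Aa Bb) pa.
  by exists (1 - s) => i; rewrite E; ring.
have [g Eg] : exists g : X -> R, forall x, x != q ->
    forall i, F i x = F i p + g x * (F i a0 - F i p).
  apply: (@fin_all_exists _ _ (fun x gx => _ -> forall i, F i x = _ + gx * _)).
  move=> x; case: (cover x) => [Ax|Bx|->|->].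
  - have [r Er] := opp _ _ Aa0 Bb0.
    have [s s1 Es] := btw_ray (btw_sym (H _ _ Ax Bb0)) (Bp _ Bb0).
    exists ((1 - s) * r) => _ i; rewrite Es.
    by have := Er i => E; rewrite -mulrA -E; ring.
  - have [r Er] := opp _ _ Aa0 Bx; exists r => _ i.
    by rewrite -Er; ring.
  - by exists 0 => _ i; ring.
  (* A default value: nothing is asked of [g q]. *)
  - by exists 0; rewrite eqxx.
(* Minimising [g] makes positions measured from [o] nonnegative. *)
have [o oq omin] := @arg_minP _ _ _ p (fun x => x != q) g pq.
(* A second point of the line directs the ray; [p] serves unless it is the apex. *)
have [p' p'q p'o] : exists2 p', p' != q & p' != o.
  have [<-|po] := eqVneq p o; first by exists a0.
  by exists p.
have lt : g o < g p'.
  rewrite lt_neqAle (omin _ p'q) andbT; apply: contra_neq p'o => e.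
  by apply: F_inj => i; rewrite (Eg _ oq) (Eg _ p'q) e.
exists o; apply: (@star_two_rays o p' q ncol) => x.
have [->|xq] := eqVneq x q; first by exists 1; [exact: ler01|right=> i; ring].
exists ((g x - g o) / (g p' - g o)).
  by have := omin _ xq => ?; rewrite divr_ge0; lra.
by left=> i; rewrite (Eg _ xq) (Eg _ p'q) (Eg _ oq); field; lra.
Qed.

(** * Two sets separated by a pair of points *)

Section Separated.
Variables (A B : X -> Prop) (p q b0 : X).
Hypotheses (ncol : ~ collinear) (cover : forall x, [\/ A x, B x, x = p | x = q]).
Hypotheses (Apq : forall a, A a -> a != p /\ a != q).
Hypotheses (Bpq : forall b, B b -> b != p /\ b != q).
Hypothesis Bb0 : B b0.
Hypothesis sepAB : forall a b, A a -> B b -> btw a p b \/ btw a q b.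

(* If [p], [q] and [a] were collinear then, seen from [a], all of [B] would lie
   on their line, and, seen from [b0], so would all of [A]. *)
Lemma separated_independent a : A a ->
  independent (fun i => F i p - F i a) (fun i => F i q - F i a).
Proof.
move=> Aa; have [ap aq] := Apq Aa.
(* A nontrivial relation makes both differences multiples of a single vector [w], namely one of the
   two. *)
suff key w (c d : R) : (forall i, F i p - F i a = c * w i) ->
    (forall i, F i q - F i a = d * w i) -> False.
  move=> m n E; have [m0|m0] := eqVneq m 0.
    have [n0|n0] := eqVneq n 0; first by [].
    case: (key (fun i => F i p - F i a) 1 (- m / n)) => i; first by ring.
    apply: (mulfI n0); transitivity (- (m * (F i p - F i a))).
      by have := E i; lra.
    by field.
  case: (key (fun i => F i q - F i a) (- n / m) 1) => i; last by ring.
  apply: (mulfI m0); transitivity (- (n * (F i q - F i a))).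
    by have := E i; lra.
  by field.
move=> Ep Eq; apply: ncol; exists (F^~ a), w.
apply: (@fin_all_exists _ _ (fun x gx => forall i, F i x = _ + gx * _)).
have lineB b : B b -> exists g : R, forall i, F i b = F i a + g * w i.
  move=> Bb; case: (sepAB Aa Bb) => /btw_ray.
    by case/(_ ap) => s _ Es; exists (s * c) => i; rewrite Es Ep; ring.
  by case/(_ aq) => s _ Es; exists (s * d) => i; rewrite Es Eq; ring.
have lineA a' : A a' -> exists g : R, forall i, F i a' = F i a + g * w i.
  move=> Aa'; have [g Eg] := lineB _ Bb0; have [b0p b0q] := Bpq Bb0.
  have pE i : F i p = F i a + c * w i by rewrite -Ep; ring.
  have qE i : F i q = F i a + d * w i by rewrite -Eq; ring.
  case: (sepAB Aa' Bb0) => /btw_sym /btw_ray.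
    case/(_ b0p) => s _ Es; exists (g + s * (c - g)) => i.
    by rewrite Es pE Eg; ring.
  case/(_ b0q) => s _ Es; exists (g + s * (d - g)) => i.
  by rewrite Es qE Eg; ring.
move=> x; case: (cover x) => [/lineA|/lineB|->|->] //.
- by exists c => i; rewrite -Ep; ring.
- by exists d => i; rewrite -Eq; ring.
Qed.

(** All points are written in the independent directions [p - a] and [q - a]; only segments of the
    same kinds as those from [a] are consistent. *)
Lemma mixed_unique a b b' a' : A a -> B b -> B b' -> A a' ->
  btw a p b -> btw a q b' -> a' = a.
Proof.
move=> Aa Bb Bb' Aa' pab qab'.
have ind := separated_independent Aa.
have [ap aq] := Apq Aa; have [a'p a'q] := Apq Aa'.
have [bp bq] := Bpq Bb; have [b'p b'q] := Bpq Bb'.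
have [be be1 Eb] := btw_ray pab ap.
have [ga ga1 Eb'] := btw_ray qab' aq.
case: (sepAB Aa' Bb) => [a'pb|a'qb]; case: (sepAB Aa' Bb') => [a'pb'|a'qb'].
(* Here [b'] would lie on the line through [a] and [p], so that [ga = 0]. *)
- have [s _ Es] := btw_ray (btw_sym a'pb) bp.
  have [r _ Er] := btw_ray a'pb' a'p.
  have [|_ e] := ind ((be + s * (1 - be)) * (1 - r) + r) (- ga); last by exfalso; lra.
  by move=> i; have := Er i; rewrite Eb' Es Eb => e; lra.
(* Here [a'] is on both lines, through [a] and [p] and through [a] and [q], which meet only at
   [a]. *)
- have [s _ Es] := btw_ray (btw_sym a'pb) bp.
  have [r _ Er] := btw_ray (btw_sym a'qb') b'q.
  have [|e _] := ind (be + s * (1 - be)) (- (ga + r * (1 - ga))).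
    by move=> i; have := Er i; rewrite Eb' Es Eb => e; lra.
  apply: F_inj => i; rewrite Es Eb.
  by transitivity (F i a + (be + s * (1 - be)) * (F i p - F i a));
    [ring | rewrite e; ring].
(* The coefficients of [p - a] give [r = (1 - s) * be], nonpositive as [1 <= s], against
   [1 <= r]. *)
- have [s s1 Es] := btw_ray (btw_sym a'qb) bq.
  have [r r1 Er] := btw_ray (btw_sym a'pb') b'p.
  have [|e _] := ind ((1 - s) * be - r) (s - (1 - r) * ga); last by exfalso; nra.
  by move=> i; have := Er i; rewrite Eb' Es Eb => e; lra.
- have [s _ Es] := btw_ray (btw_sym a'qb') b'q.
  have [r _ Er] := btw_ray a'qb a'q.
  have [|e _] := ind (- be) ((ga + s * (1 - ga)) * (1 - r) + r); last by exfalso; lra.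
  by move=> i; have := Er i; rewrite Eb Es Eb' => e; lra.
Qed.

Lemma mixed_two_rays a b b' : A a -> B b -> B b' ->
  btw a p b -> btw a q b' -> exists o f, two_rays o f.
Proof.
move=> Aa Bb Bb' pab qab'; have [ap aq] := Apq Aa.
exists a; apply: (@star_two_rays a p q ncol) => x.
case: (cover x) => [Ax|Bx|->|->].
- exists 0 => //; left=> i.
  by rewrite (mixed_unique Aa Bb Bb' Ax pab qab'); ring.
- case: (sepAB Aa Bx) => [/btw_ray/(_ ap)|/btw_ray/(_ aq)] [s s1 E].
    by exists s; [lra|left].
  by exists s; [lra|right].
- by exists 1 => //; left=> i; ring.
- by exists 1 => //; right=> i; ring.
Qed.

End Separated.

(** Without a point having segments of both kinds, the kind of the segment from [a0] to [b0] passes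
    to that from [a0] to [b], then to that from [a] to [b]. *)
Lemma separated_two_rays (A B : X -> Prop) (p q a0 b0 : X) : ~ collinear ->
  (forall x, [\/ A x, B x, x = p | x = q]) -> p != q ->
  (forall a, A a -> a != p /\ a != q) -> (forall b, B b -> b != p /\ b != q) ->
  A a0 -> B b0 ->
  (forall a b, A a -> B b -> btw a p b \/ btw a q b) ->
  exists o f, two_rays o f.
Proof.
move=> ncol cover pq Apq Bpq Aa0 Bb0 sepAB.
apply: contrapT => no.
have cover' x : [\/ B x, A x, x = p | x = q].
  by case: (cover x); [constructor 2|constructor 1|constructor 3|constructor 4].
have sepBA b a : B b -> A a -> btw b p a \/ btw b q a.
  by move=> Bb /sepAB /(_ Bb) [] /btw_sym; [left|right].
have nomixA a b b' : A a -> B b -> B b' -> btw a p b -> btw a q b' -> False.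
  by move=> Aa Bb Bb' h h'; apply: no; apply: (mixed_two_rays ncol cover
    Apq Bpq Bb0 sepAB Aa Bb Bb' h h').
have nomixB b a a' : B b -> A a -> A a' -> btw b p a -> btw b q a' -> False.
  by move=> Bb Aa Aa' h h'; apply: no; apply: (mixed_two_rays ncol cover'
    Bpq Apq Aa0 sepBA Bb Aa Aa' h h').
case: (sepAB _ _ Aa0 Bb0) => h0; apply: no.
- apply: (one_type ncol cover pq Apq _ Aa0 Bb0) => [b /Bpq[] //|a b Aa Bb].
  case: (sepAB _ _ Aa Bb) => // h.
  case: (sepAB _ _ Aa0 Bb) => h'; last by case: (nomixA _ _ _ Aa0 Bb0 Bb h0 h').
  by case: (nomixB _ _ _ Bb Aa0 Aa (btw_sym h') (btw_sym h)).
- have coverqp x : [\/ A x, B x, x = q | x = p].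
    by case: (cover x); [constructor 1|constructor 2|constructor 4|constructor 3].
  rewrite eq_sym in pq.
  apply: (one_type ncol coverqp pq _ _ Aa0 Bb0) => [a /Apq[]//|b /Bpq[] //|a b Aa Bb].
  case: (sepAB _ _ Aa Bb) => // h.
  case: (sepAB _ _ Aa0 Bb) => h'; first by case: (nomixA _ _ _ Aa0 Bb Bb0 h' h0).
  by case: (nomixB _ _ _ Bb Aa Aa0 (btw_sym h) (btw_sym h')).
Qed.

(** For the case of three vertices, where 3-connectedness fails by cardinality and yields no
    separator. *)
Lemma three_points_two_rays (a b c : X) : ~ collinear ->
  (forall x, [\/ x = a, x = b | x = c]) -> exists o f, two_rays o f.
Proof.
move=> ncol cover; exists a; apply: (@star_two_rays a b c ncol) => x.
case: (cover x) => ->.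
- by exists 0 => //; left=> i; ring.
- by exists 1 => //; left=> i; ring.
- by exists 1 => //; right=> i; ring.
Qed.

(** * Betweenness on two rays *)

Lemma two_rays_apex o f : two_rays o f -> f o = 0.
Proof.
case=> [[u [w [ind E]]]] _.
have [|] := ind (Num.max (- f o) 0) (Num.max (f o) 0).
  by move=> i; have := E o i; lra.
by case: (lerP (- f o) 0); case: (lerP (f o) 0); lra.
Qed.

Lemma two_rays_inj o f : two_rays o f -> injective f.
Proof.
case=> [[u [w [_ E]]]] _ x y fxy.
by apply: F_inj => i; rewrite E fxy -E.
Qed.

(** Along one ray, apex included, betweenness is the order of [f]; a segment across the apex meets
    the rays only at its ends. *)
Lemma two_rays_btw o f x z y : two_rays o f -> f x < f y -> z != x -> z != y ->
  btw x z y <-> (f x < f z < f y /\ ~~ (f x < 0 < f y)).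
Proof.
move=> rays fxy zx zy; have inj := two_rays_inj rays.
have nzx : f z != f x by rewrite (inj_eq inj).
have nzy : f z != f y by rewrite (inj_eq inj).
case: rays => [[u [w [ind E]]]] _; split=> [[t [t01 Et]]|].
  have [|] := ind (Num.max (- f z) 0 - (1 - t) * Num.max (- f x) 0
                    - t * Num.max (- f y) 0)
    (Num.max (f z) 0 - (1 - t) * Num.max (f x) 0 - t * Num.max (f y) 0).
    by move=> i; have := Et i; rewrite (E z) (E x) (E y); lra.
  have t0 : t != 0.
    apply: contra_neq zx => t0; apply: F_inj => i.
    by rewrite Et t0; ring.
  have t1 : t != 1.
    apply: contra_neq zy => t1; apply: F_inj => i.
    by rewrite Et t1; ring.
  move=> eN eP; apply: (@signed_convex _ _ _ _ t) => //; [|lra|lra].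
  by rewrite !lt_neqAle eq_sym t0 t1.
case=> xzy /negP xy0.
case: (lerP (f y) 0) => y0.
  (* The coordinate [f] decreases along [u], hence the direction [- u]. *)
  apply: (@line_btw (F^~ o) (fun i => - u i) f) (xzy) => i;
    by rewrite E max_l ?max_r; lra.
have x0 : 0 <= f x by rewrite leNgt; apply/negP => x0; apply: xy0; rewrite x0.
by apply: (@line_btw (F^~ o) w f) (xzy) => i; rewrite E max_r ?max_l; lra.
Qed.

End Geometry.

(* An inner product space is identified with its family of linear functionals
   [ip w], so that vector identities become families of scalar ones. *)
Lemma hilbert_btw (R : realType) (X : finMetricType R) : hilbert_embeddable X ->
  exists (I : Type) (F : I -> X -> R),
    (forall x y, (forall i, F i x = F i y) -> x = y) /\
    forall x z y, mdist x z + mdist z y = mdist x y <-> btw F x z y.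
Proof.
case=> H [phi [[ip ipE] dE]].
have sym u v : ip u v = ip v u by rewrite hermC expr0 mul1r.
have ipD w u v : ip w (u + v) = ip w u + ip w v by exact: linearDr.
have ipB w u v : ip w (u - v) = ip w u - ip w v by exact: linearBr.
have ipZ w c u : ip w (c *: u) = c * ip w u by exact: linearZr.
have ext (u v : H) : (forall w, ip w u = ip w v) -> u = v.
  move=> E; apply/eqP; rewrite -subr_eq0 -normr_eq0 -sqrf_eq0 ipE.
  by rewrite ipB E subrr.
(* Equality in the triangle inequality: it gives [ip u v = |u| * |v|], so the difference of the two
   sides has norm zero. *)
have par (u v : H) : `|u + v| = `|u| + `|v| -> `|v| *: u = `|u| *: v.
  move=> uv; have uE := ipE u; have vE := ipE v; have := ipE (u + v).
  rewrite uv ipD !(sym (u + v)) !ipD (sym v u) -uE -vE => uvE.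
  have ipuv : ip u v = `|u| * `|v| by lra.
  apply/eqP; rewrite -subr_eq0 -normr_eq0 -sqrf_eq0 ipE.
  rewrite ipB !(sym (_ - _)) !ipB !ipZ !(sym (_ *: _)) !ipZ (sym v u) -uE -vE ipuv.
  by apply/eqP; ring.
exists H, (fun w x => ip w (phi x)); split=> [x y /ext E|x z y].
  by apply: mdist_positivity; rewrite -dE E subrr normr0.
split=> [e|[t [t01 E]]]; last first.
  have Ez : phi z = (1 - t) *: phi x + t *: phi y.
    by apply: ext => w; rewrite E ipD !ipZ.
  have -> : mdist x z = t * mdist x y.
    rewrite -!dE Ez -[t in RHS]ger0_norm; last by case/andP: t01.
    rewrite -normrZ; congr (`|_|).
    by apply: ext => w; rewrite !(ipB, ipD, ipZ); ring.
  have -> : mdist z y = (1 - t) * mdist x y.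
    rewrite -!dE Ez -[1 - t in RHS]ger0_norm; last by lra.
    rewrite -normrZ; congr (`|_|).
    by apply: ext => w; rewrite !(ipB, ipD, ipZ); ring.
  by ring.
have prop : mdist z y *: (phi z - phi x) = mdist x z *: (phi y - phi z).
  have nu : `|phi z - phi x| = mdist x z by rewrite -dE distrC.
  have nv : `|phi y - phi z| = mdist z y by rewrite -dE distrC.
  rewrite -nu -nv; apply: par.
  by rewrite nu nv addrC subrKA -normrN opprB dE e.
(* The ratio of distances used below as parameter needs [mdist x y] nonzero. *)
have [xy|xy] := eqVneq (mdist x y) 0.
  have zx : z = x.
    apply/esym/mdist_positivity; have := mdist_ge0 x z; have := mdist_ge0 z y.
    by lra.
  by exists 0; split=> [|w]; [rewrite lexx ler01 | rewrite zx; ring].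
have xz0 := mdist_ge0 x z; have zy0 := mdist_ge0 z y.
have xy0 : 0 < mdist x y by rewrite lt_neqAle eq_sym xy mdist_ge0.
exists (mdist x z / mdist x y); split=> [|w].
  by apply/andP; split; [rewrite divr_ge0 // ltW | rewrite ler_pdivrMr //; lra].
have := congr1 (ip w) prop; rewrite !ipZ !ipB => E.
apply: (mulfI xy).
transitivity (mdist z y * ip w (phi x) + mdist x z * ip w (phi y)).
  by rewrite -e; lra.
by rewrite -e; field; rewrite e.
Qed.

(** * Metric betweenness and separators of the critical graph *)

Section Critical.
Variables (R : realType) (X : finMetricType R).

Lemma criticalP (x y : X) : reflect
  (x != y /\ forall z, mdist x z + mdist z y = mdist x y -> z = x \/ z = y)
  (critical x y).
Proof.
apply: (iffP andP) => -[xy H]; split=> //.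
  move=> z e; have := forallP H z; rewrite e ltxx implybF negb_and !negbK.
  by case/orP => /eqP ->; [left|right].
apply/forallP => z; apply/implyP => /andP[zx zy].
rewrite lt_neqAle metric_triangle andbT; apply/eqP => /esym /H.
by case=> e; [rewrite e eqxx in zx|rewrite e eqxx in zy].
Qed.

Lemma mdist_btw_trans (a z b s : X) :
  mdist a z + mdist z b = mdist a b -> mdist z s + mdist s b = mdist z b ->
  mdist a s + mdist s b = mdist a b.
Proof.
move=> e e'; have := metric_triangle a s b; have := metric_triangle a z s; lra.
Qed.

Let between (a b : X) : {set X} := [set z | mdist a z + mdist z b == mdist a b].

Lemma between_proper (a z b : X) : z != a ->
  mdist a z + mdist z b = mdist a b -> (#|between z b| < #|between a b|)%N.
Proof.
move=> za e; apply: proper_card; apply/properP; split.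
  by apply/subsetP => s; rewrite !inE => /eqP /(mdist_btw_trans e) ->.
exists a; first by rewrite inE mdistxx add0r.
have: 0 < mdist a z by rewrite mdist_gt0 eq_sym.
by rewrite inE => az; apply/eqP; rewrite (metric_sym z a); lra.
Qed.

Lemma separator_between (A S : {set X}) :
  (forall a b, a \in A -> b \notin A -> b \notin S -> ~~ critical a b) ->
  [disjoint A & S] ->
  forall a b, a \in A -> b \notin A -> b \notin S ->
    exists2 s, s \in S & mdist a s + mdist s b = mdist a b.
Proof.
move=> noedge dis a b.
have [n] := ubnP #|between a b|; elim: n a b => // n IHn a b leab Aa nAb nSb.
have ab : a != b by apply: contraNneq nAb => <-.
have /criticalP := noedge a b Aa nAb nSb.
move=> nc; have [z [e [za zb]]] : exists z,
    mdist a z + mdist z b = mdist a b /\ z != a /\ z != b.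
  apply: contrapT => no; apply: nc; split=> // z e.
  have [->|za] := eqVneq z a; first by left.
  have [->|zb] := eqVneq z b; first by right.
  by case: no; exists z.
have [Sz|nSz] := boolP (z \in S); first by exists z.
have [Az|nAz] := boolP (z \in A).
  have [|s Ss es] := IHn z b _ Az nAb nSb.
    exact: leq_trans (between_proper za e) _.
  by exists s => //; apply: mdist_btw_trans es.
have e' : mdist b z + mdist z a = mdist b a.
  by rewrite addrC (metric_sym z a) (metric_sym b z) (metric_sym b a).
have betC c d : #|between c d| = #|between d c|.
  apply: eq_card => s; rewrite !inE addrC (metric_sym c s) (metric_sym s d).
  by rewrite (metric_sym c d).
have [|s Ss es] := IHn a z _ Aa nAz nSz.
  rewrite betC; apply: leq_trans (between_proper zb e') _.
  by rewrite betC.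
exists s => //; rewrite addrC (metric_sym s b) (metric_sym a s) (metric_sym a b).
apply: mdist_btw_trans e' _.
by rewrite addrC (metric_sym s a) (metric_sym z s) (metric_sym z a).
Qed.

End Critical.

Lemma vertex_separator (V : finType) (e : rel V) (m : nat) :
  vertex_connected e m -> ~ vertex_connected e m.+1 ->
  #|V| = m.+1 \/
  exists (S A : {set V}) (x y : V), [/\ #|S| = m, [disjoint A & S], x \in A,
    y \notin A /\ y \notin S &
    forall a b, a \in A -> b \notin A -> b \notin S -> ~~ e a b].
Proof.
case=> mV conn nconn; have [->|Vm] := eqVneq #|V| m.+1; [by left|right].
apply: contrapT => no; apply: nconn; split; first by rewrite ltn_neqAle eq_sym Vm.
move=> S Sm x y nSx nSy; apply: contrapT => nxy.
have Sm' : #|S| = m.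
  by apply/eqP; rewrite eqn_leq -ltnS Sm leqNgt /=; apply/negP => /conn /(_ x y nSx nSy).
apply: no; exists S, [set z | (z \notin S) && connect (delete_vertices e S) x z], x, y.
split=> //.
- by rewrite disjoint_subset; apply/subsetP => z; rewrite !inE => /andP[].
- by rewrite inE nSx connect0.
- by split=> //; rewrite inE nSy; apply/negP.
move=> a b; rewrite !inE => /andP[nSa xa] + nSb; rewrite nSb /=.
apply: contra => eab; apply: connect_trans xa _; apply: connect1.
by rewrite /delete_vertices nSa nSb.
Qed.

Lemma rank_enumeration (R : realType) (X : finType) (f : X -> R) :
  injective f ->
  exists v : 'I_#|X| -> X, bijective v /\
    forall i j : 'I_#|X|, (i < j)%N = (f (v i) < f (v j)).
Proof.
move=> finj.
have rank_lt x : (#|[set y | (f y < f x)%R]| < #|X|)%N.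
  rewrite -cardsT; apply: proper_card; apply/properP; split; first exact: subsetT.
  by exists x; rewrite ?inE ?ltxx.
pose r x : 'I_#|X| := Ordinal (rank_lt x).
have r_homo x y : f x < f y -> (r x < r y)%N.
  move=> xy; apply: proper_card; apply/properP; split.
    by apply/subsetP => z; rewrite !inE => /lt_trans; apply.
  by exists x; rewrite !inE ?ltxx.
have r_inj : injective r.
  move=> x y rxy; apply: finj; apply: le_anti; rewrite !leNgt.
  by apply/andP; split; apply/negP => /r_homo; rewrite rxy ltnn.
have [v rK vK] : bijective r by apply: inj_card_bij; rewrite ?card_ord.
exists v; split; first by exists r.
move=> i j; apply/idP/idP => [ij|/r_homo]; last by rewrite !vK.
rewrite ltNge; apply/negP; rewrite le_eqVlt => /orP[/eqP/finj ji|/r_homo].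
  by move: ij; rewrite -(vK i) -(vK j) ji ltnn.
by rewrite !vK ltnNge ltnW.
Qed.

Lemma collinear_not_2connected (R : realType) (X : finMetricType R) (I : Type)
    (F : I -> X -> R) :
  (forall x y, (forall i, F i x = F i y) -> x = y) ->
  (forall x z y, mdist x z + mdist z y = mdist x y <-> btw F x z y) ->
  collinear F -> ~ vertex_connected (@critical R X) 2.
Proof.
move=> F_inj btwE [c [u [g E]]] [X2 conn].
have g_inj : injective g by move=> x y e; apply: F_inj => i; rewrite !E e.
have [v [[r vK rK] vlt]] := rank_enumeration g_inj.
pose k0 := Ordinal (ltnW (ltnW X2)); pose k1 := Ordinal (ltnW X2); pose k2 := Ordinal X2.
have v01 : g (v k0) < g (v k1) by rewrite -vlt.
have v12 : g (v k1) < g (v k2) by rewrite -vlt.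
have nocross x y : g x < g (v k1) -> g (v k1) < g y -> ~~ critical x y.
  move=> x1 y1; apply/negP => /criticalP[_ H].
  have : mdist x (v k1) + mdist (v k1) y = mdist x y.
    by apply/btwE; apply: (line_btw (E x) (E (v k1)) (E y)); rewrite x1.
  by case/H => e; [rewrite e ltxx in x1|rewrite e ltxx in y1].
have cl : closed_mem (delete_vertices (@critical R X) [set v k1])
    (mem [pred x | g x < g (v k1)]).
  move=> x y; rewrite /delete_vertices !inE => /and3P[xk yk xy].
  have lt z : z != v k1 -> (g z < g (v k1)) = ~~ (g (v k1) < g z).
    by move=> zk; rewrite -leNgt le_eqVlt (inj_eq g_inj) (negPf zk).
  have [x1|x1] := ltP (g x) (g (v k1)).
    apply/esym; rewrite lt //; apply: contraL xy => y1; exact: nocross.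
  apply/esym; apply: contraTF xy => y1; rewrite critical_sym; apply: nocross => //.
  by rewrite lt_neqAle eq_sym (inj_eq g_inj) xk.
have := conn [set v k1] _ (v k0) (v k2).
rewrite cards1 !inE !(inj_eq (can_inj vK)) => /(_ isT isT isT) /(closed_connect cl).
by rewrite !inE v01 ltNge ltW.
Qed.

Lemma critical_two_rays (R : realType) (X : finMetricType R) :
  hilbert_embeddable X ->
  vertex_connected (@critical R X) 2 ->
  ~ vertex_connected (@critical R X) 3 ->
  exists (o : X) (f : X -> R), [/\ injective f, f o = 0, exists x, f x < 0,
    exists x, 0 < f x &
    forall x y, f x < f y ->
      critical x y <-> f x < 0 < f y \/ ~ exists z, f x < f z < f y].
Proof.
case/hilbert_btw => I [F [F_inj btwE]] con2 ncon3.
have ncol : ~ collinear F by move=> /(collinear_not_2connected F_inj btwE).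
have [o [f rays]] : exists o f, two_rays F o f.
  case: (vertex_separator con2 ncon3) => [X3|[S [A [x [y [S2 dis Ax [nAy nSy] noedge]]]]]].
    move: X3; rewrite cardE; case E: (enum X) => [|a [|b [|c [|d s]]]] //= _.
    apply: (three_points_two_rays (a := a) (b := b) (c := c) ncol) => z.
    by have := mem_enum X z; rewrite E !inE => /or3P[] /eqP ->;
      [constructor 1|constructor 2|constructor 3].
  have sep := separator_between noedge dis.
  have /cards2P [p [q [pq E]]] : #|S| == 2%N by rewrite S2.
  apply: (separated_two_rays F_inj (A := [in A]) (B := fun z => z \notin A /\ z \notin S)
    (p := p) (q := q) ncol _ pq _ _ Ax (conj nAy nSy)).
  - move=> z; have [Az|nAz] := boolP (z \in A); first by constructor 1.
    have [|nSz] := boolP (z \in S); last by constructor 2.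
    by rewrite E !inE => /orP[] /eqP ->; [constructor 3|constructor 4].
  - move=> a Aa; have := disjointFr dis Aa; rewrite E !inE => /negbT.
    by rewrite negb_or => /andP.
  - by move=> b [_]; rewrite E !inE negb_or => /andP.
  - move=> a b Aa [nAb nSb]; have [s] := sep a b Aa nAb nSb.
    by rewrite E !inE => /orP[] /eqP -> /btwE; [left|right].
have f_inj := two_rays_inj F_inj rays.
exists o, f; split=> //; [exact: two_rays_apex rays | by case: rays => _ []
  | by case: rays => _ [] |].
move=> x y xy; split=> [/criticalP[_ H]|H].
  have [|n] := boolP (f x < 0 < f y); [by left|right=> -[z xzy]].
  have zx : z != x by apply: contraTneq xzy => ->; rewrite ltxx.
  have zy : z != y by apply: contraTneq xzy => ->; rewrite ltxx andbF.
  have /btwE/H : btw F x z y by apply/(two_rays_btw F_inj rays).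
  by case=> e; [rewrite e eqxx in zx|rewrite e eqxx in zy].
apply/criticalP; split=> [|z /btwE b]; first by apply: contraTneq xy => ->; rewrite ltxx.
have [->|zx] := eqVneq z x; first by left.
have [->|zy] := eqVneq z y; first by right.
have [xzy n] := (two_rays_btw F_inj rays xy zx zy).1 b.
by case: H => [H|[]]; [rewrite H in n|exists z].
Qed.

(* The vertex written v_(i+1) in one-based indexing is [v i], [i : 'I_#|X|];
   [k] is kept one-based. *)
Theorem theorem2 (R : realType) (X : finMetricType R) :
  hilbert_embeddable X ->
  vertex_connected (@critical R X) 2 ->
  ~ vertex_connected (@critical R X) 3 ->
  exists v : 'I_#|X| -> X,
    hamiltonian_path (@critical R X) v /\
    exists k : nat,
      (2 <= k <= #|X| - 1)%N /\
      forall i j : 'I_#|X|, (i < j)%N ->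
        (critical (v i) (v j) <->
         (j - i = 1)%N \/ (i.+1 < k < j.+1)%N).
Proof.
move=> emb con2 ncon3.
have [o [f [f_inj fo [x x0] [y y0] critE]]] := critical_two_rays emb con2 ncon3.
have [v [v_bij vlt]] := rank_enumeration f_inj; have [r vK rK] := v_bij.
have xo : (r x < r o)%N by rewrite vlt !rK fo.
have oy : (r o < r y)%N by rewrite vlt !rK fo.
have adjE (i j : 'I_#|X|) : (i < j)%N ->
    (critical (v i) (v j) <-> (j - i = 1)%N \/ (i.+1 < (r o).+1 < j.+1)%N).
  move=> ij; have vij : f (v i) < f (v j) by rewrite -vlt.
  have -> : (i.+1 < (r o).+1 < j.+1)%N = (f (v i) < 0 < f (v j)).
    by rewrite !ltnS !vlt rK fo.
  apply: (iff_trans (critE _ _ vij)); split=> -[]; [by right| |move=> ji|by left].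
    move=> no; left; apply: contrapT => ji; apply: no.
    have iX : (i.+1 < #|X|)%N by apply: leq_ltn_trans (ltn_ord j).
    exists (v (Ordinal iX)); rewrite -!vlt /= ltnSn ltn_neqAle ij andbT.
    by apply/eqP => e; apply: ji; rewrite -e subSnn.
  right=> -[z]; rewrite -(rK z) -!vlt => /andP[iz zj].
  have := leq_ltn_trans iz zj.
  by rewrite -(subnK (ltnW ij)) ji add1n ltnn.
exists v; split.
  split=> // i j ji; have ij : (i < j)%N by rewrite ji.
  by apply/(adjE _ _ ij); left; rewrite ji subSnn.
exists (r o).+1; split=> //.
have oX := leq_ltn_trans oy (ltn_ord (r y)).
by rewrite ltnS (leq_ltn_trans (leq0n _) xo) subn1 -ltnS (ltn_predK oX).
Qed.
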